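(* Let $(\mathcal{R},\mu)$ be a $\sigma$-finite resonant measure space and let $X$ be a rearrangement-invariant Banach function space over $(\mathcal{R},\mu)$. Then $X$ is $\xi$-complete, i.e. every Cauchy net in $(X,\xi)$ converges in $(X,\xi)$.
   Context: $\mathcal{M}=\mathcal{M}(\mathcal{R},\mu)$ is the set of extended complex-valued $\mu$-measurable functions on $\mathcal{R}$ (identified when equal $\mu$-a.e.), $\mathcal{M}_+$ the non-negative ones; $\lambda$ is Lebesgue measure. For $f\in\mathcal{M}$ put $f_*(s)=\mu(\{|f|>s\})$ and $f^*(t)=\inf\{s\ge0:\ f_*(s)\le t\}$. A $\sigma$-finite $(\mathcal{R},\mu)$ is resonant if $\sup_{\tilde g^*=g^*}\int_{\mathcal{R}}|f\tilde g|\,d\mu=\int_0^\infty f^*g^*\,d\lambda$ for all $f,g\in\mathcal{M}$ (equivalently, it is non-atomic, or completely atomic with all atoms of equal measure). A Banach function norm is a map $\lVert\cdot\rVert\colon\mathcal{M}\to[0,\infty]$ with $\lVert\,|f|\,\rVert=\lVert f\rVert$ whose restriction to $\mathcal{M}_+$ satisfies: (P1) it is absolutely homogeneous, vanishes exactly at $f=0$ a.e., and is subadditive; (P2) $f\le g$ a.e. implies $\lVert f\rVert\le\lVert g\rVert$; (P3) $f_n\uparrow f$ a.e. implies $\lVert f_n\rVert\uparrow\lVert f\rVert$; (P4) $\lVert\chi_E\rVert<\infty$ if $\mu(E)<\infty$; (P5) if $\mu(E)<\infty$ there is a finite $C_E$ with $\int_E f\,d\mu\le C_E\lVert f\rVert$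 for all $f\in\mathcal{M}_+$. It is rearrangement-invariant (r.i.) if $f^*=g^*$ implies $\lVert f\rVert=\lVert g\rVert$. The corresponding space is $X=\{f\in\mathcal{M}:\lVert f\rVert_X<\infty\}$; its associate space is $X'=\{f\in\mathcal{M}:\lVert f\rVert_{X'}<\infty\}$, $\lVert f\rVert_{X'}=\sup_{\lVert g\rVert_X\le1}\int_{\mathcal{R}}|fg|\,d\mu$. $\xi$ is the locally convex topology on $X$ induced by the norms $|f|_\varphi=\int_0^\infty\varphi^*f^*\,d\lambda$, $\varphi\in X'$. *)

(* Defs.v *)
From HB Require Import structures.
From mathcomp Require Import all_boot all_order all_algebra.
From mathcomp Require Import all_classical all_reals all_analysis.
From mathcomp Require Import measurable_realfun complex.

Set Implicit Arguments.
Unset Strict Implicit.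
Unset Printing Implicit Defensive.

Import Order.TTheory GRing.Theory Num.Theory.
Import numFieldNormedType.Exports.

Local Open Scope classical_set_scope.
Local Open Scope ring_scope.

(* Extended complex numbers C u {oo}: [None] is the point at infinity, of
   modulus +oo. *)
Definition ecomplex (R : realType) : Type := option R[i].

Section ecomplex.
Variable R : realType.
Implicit Types z w : ecomplex R.

Definition ec_abs z : \bar R :=
  if z is Some c then (ComplexField.Normc.normc c)%:E else +oo%E.

(* A total function: it sends (oo, _) and (_, oo) to oo.  Below, only
   differences of functions that are finite almost everywhere matter. *)
Definition ec_sub z w : ecomplex R :=
  match z, w with
  | Some a, Some b => Some (a - b)
  | _, _ => None
  end.

Definition ec_Re z : R := if z is Some c then complex.Re c else 0.
Definition ec_Im z : R := if z is Some c then complex.Im c else 0.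

(* The embedding of [0, +oo] into C u {oo}; the value at -oo is irrelevant. *)
Definition ec_of_ereal (x : \bar R) : ecomplex R :=
  if x is r%:E%E then Some (real_complex R r) else None.

End ecomplex.

Section measurable_functions.
Variables (R : realType) (d : measure_display) (T : measurableType d).
Implicit Types f g : T -> ecomplex R.

Definition ecabs f : T -> \bar R := fun x => ec_abs (f x).

Definition ecsub f g : T -> ecomplex R := fun x => ec_sub (f x) (g x).

(* Functions are not quotiented by almost everywhere equality; every notion
   below is compatible with it on [Mfun]. *)
Definition Mfun : set (T -> ecomplex R) :=
  [set f | [/\ measurable [set x | f x = None],
               measurable_fun [set: T] (fun x => ec_Re (f x)) &
               measurable_fun [set: T] (fun x => ec_Im (f x))]].

(* The cone M_+ , seen as a set of [0, +oo]-valued functions. *)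
Definition Mplus : set (T -> \bar R) :=
  [set u : T -> \bar R | measurable_fun [set: T] u /\ forall x, (0 <= u x)%E].

Definition of_Mplus (u : T -> \bar R) : T -> ecomplex R :=
  fun x => ec_of_ereal (u x).

End measurable_functions.

Section rearrangement.
Variables (R : realType) (d : measure_display) (T : measurableType d).
Variable mu : {measure set T -> \bar R}.
Implicit Types f g : T -> ecomplex R.

Local Open Scope ereal_scope.

Definition distribution_function f (s : R) : \bar R :=
  mu [set x | s%:E < ecabs f x].

(* f^*(t), for t >= 0; the infimum of the empty set is +oo. *)
Definition rearrangement f (t : R) : \bar R :=
  ereal_inf [set s%:E | s in [set s : R | (0 <= s)%R /\
                                          distribution_function f s <= t%:E]].

Definition equimeasurable f g : Prop :=
  forall t : R, (0 <= t)%R -> rearrangement f t = rearrangement g t.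

(* \int_0^\infty f^* g^* d\lambda *)
Definition rearrangement_pairing f g : \bar R :=
  \int[@lebesgue_measure R]_(t in `[0%R, +oo[)
    (rearrangement f t * rearrangement g t).

Definition resonant : Prop :=
  forall f g, Mfun f -> Mfun g ->
    ereal_sup [set \int[mu]_x (ecabs f x * ecabs g' x)
              | g' in [set g' | Mfun g' /\ equimeasurable g' g]] =
    rearrangement_pairing f g.

Variable rho : (T -> ecomplex R) -> \bar R.

(* [rho] on M_+; only the values of [rho] on [Mfun] are constrained. *)
Local Notation rhop u := (rho (of_Mplus u)).

Record banach_function_norm : Prop := BanachFunctionNorm {
  bfn_ge0 : forall f, Mfun f -> 0 <= rho f ;
  bfn_abs : forall f, Mfun f -> rhop (ecabs f) = rho f ;
  bfn_homog : forall (a : R) u, (0 <= a)%R -> Mplus u ->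
    rhop (fun x => a%:E * u x) = a%:E * rhop u ;
  bfn_eq0 : forall u, Mplus u ->
    rhop u = 0 <-> {ae mu, forall x, u x = 0} ;
  bfn_subadd : forall u v, Mplus u -> Mplus v ->
    rhop (fun x => u x + v x) <= rhop u + rhop v ;
  bfn_monotone : forall u v, Mplus u -> Mplus v ->
    {ae mu, forall x, u x <= v x} -> rhop u <= rhop v ;
  bfn_fatou : forall (u_ : nat -> T -> \bar R) (u : T -> \bar R),
    (forall n, Mplus (u_ n)) -> Mplus u ->
    {ae mu, forall x, (forall n, u_ n x <= u_ n.+1 x) /\
                      u_ n x @[n --> \oo] --> u x} ->
    (forall n, rhop (u_ n) <= rhop (u_ n.+1)) /\
    rhop (u_ n) @[n --> \oo] --> rhop u ;
  bfn_indic : forall E : set T, measurable E -> mu E < +oo ->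
    rhop (fun x => (\1_E x)%:E) < +oo ;
  bfn_int : forall E : set T, measurable E -> mu E < +oo ->
    exists2 C : R, (0 < C)%R &
      forall u, Mplus u -> \int[mu]_(x in E) u x <= C%:E * rhop u }.

Definition rearrangement_invariant : Prop :=
  forall f g, Mfun f -> Mfun g -> equimeasurable f g -> rho f = rho g.

Definition bf_space : set (T -> ecomplex R) :=
  [set f | Mfun f /\ rho f < +oo].

Definition associate_norm f : \bar R :=
  ereal_sup [set \int[mu]_x (ecabs f x * ecabs g x)
            | g in [set g | Mfun g /\ rho g <= 1]].

Definition associate_space : set (T -> ecomplex R) :=
  [set f | Mfun f /\ associate_norm f < +oo].

(* The filter of neighbourhoods of f in (X, xi): it is generated by the balls
   around f of positive radius for the maxima of finitely many of the norms
   |.|_phi, phi in X'. *)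
Definition xi_nbhs f : set_system (T -> ecomplex R) :=
  filter_from
    [set P : set (T -> ecomplex R) * R |
      [/\ finite_set P.1, P.1 `<=` associate_space & (0 < P.2)%R]]
    (fun P => [set g | bf_space g /\
       forall phi, P.1 phi ->
         rearrangement_pairing phi (ecsub g f) < P.2%:E]).

End rearrangement.

Section nets.

Definition directed (I : Type) (le : I -> I -> Prop) : Prop :=
  [/\ exists i : I, True,
      forall i, le i i,
      forall i j k, le i j -> le j k -> le i k &
      forall i j, exists k, le i k /\ le j k].

Definition tails (I : Type) (le : I -> I -> Prop) : set_system I :=
  [set A | exists i0, forall i, le i0 i -> A i].

Variables (R : realType) (d : measure_display) (T : measurableType d).
Variables (mu : {measure set T -> \bar R}) (rho : (T -> ecomplex R) -> \bar R).
Variables (I : Type) (le : I -> I -> Prop) (x : I -> T -> ecomplex R).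

Definition xi_cauchy_net : Prop :=
  forall U, xi_nbhs mu rho (fun=> Some 0) U ->
    exists i0, forall i j, le i0 i -> le i0 j -> U (ecsub (x i) (x j)).

Definition xi_net_cvg (f : T -> ecomplex R) : Prop :=
  x @ tails le --> xi_nbhs mu rho f.

End nets.

Definition xi_complete (R : realType) (d : measure_display)
    (T : measurableType d) (mu : {measure set T -> \bar R})
    (rho : (T -> ecomplex R) -> \bar R) : Prop :=
  forall (I : Type) (le : I -> I -> Prop) (x : I -> T -> ecomplex R),
    directed le -> (forall i, bf_space rho (x i)) ->
    xi_cauchy_net mu rho le x ->
    exists2 f, bf_space rho f & xi_net_cvg mu rho le x f.

(* Main.v *)
Require Import Defs.
From HB Require Import structures.
From mathcomp Require Import all_boot all_order all_algebra.
From mathcomp Require Import all_classical all_reals all_analysis.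
From mathcomp Require Import measurable_realfun complex.
From mathcomp Require Import lra ring.
Set Implicit Arguments.
Unset Strict Implicit.
Unset Printing Implicit Defensive.
Import Order.TTheory GRing.Theory Num.Theory.
Import numFieldNormedType.Exports.
Local Open Scope classical_set_scope.
Local Open Scope ring_scope.

(** Why the space is complete.

    Write [|f|_phi] for the pairing of [f] and [phi].  Resonance with the
    trivial rearrangement gives [int |f phi| <= |f|_phi], so each seminorm
    controls a weighted L^1 distance.  Since functions of finite norm are
    integrable on sets of finite measure, sigma-finiteness provides one
    strictly positive weight [w] in the associate space
    ([positive_associate_weight]).  A Cauchy net is therefore Cauchy in
    L^1(w dmu), and indices chosen along its tails form a sequence with
    summable gaps, which converges almost everywhere to some [f]
    ([cauchy_net_limit]).  The limit does not depend on how far out these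
    indices are taken, so for any index [i0] there is a sequence of members
    of the net beyond [i0] that converges almost everywhere to the same [f].

    Resonance also makes [|.|_phi] lower semicontinuous under almost everywhere
    convergence: it is the supremum of the functionals [int |.| |p|] over the
    rearrangements [p] of [phi], and Fatou's lemma applies to each of them
    ([pairing_lower_semicontinuous]).  Hence the bound on [|x_i - x_j|_phi] for
    large [i], [j] passes to the limit in [j] and bounds [|x_i - f|_phi].

    What remains is that [f] has finite norm.  The previous step and the
    Hoelder inequality give [int |f| v < oo] for every [v] in the associate
    space, so the point is the qualitative Lorentz-Luxemburg theorem: such an
    [f] has finite norm ([norm_lt_pinfty_of_associate_ball]).  A gliding hump
    argument turns finiteness into a bound [int |f| v <= c] that is uniform on
    the associate unit ball, and by the Fatou property it suffices to bound the
    norm of square integrable truncations of [|f|].  For such an [f] of norm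
    greater than 1, the separation from the unit ball takes place in L^2: the
    unit ball is convex and closed under almost everywhere limits, so it has a
    point [u] nearest to [f] ([nearest_point]), and the variational inequality
    at [u] says that a multiple of [f - u] lies in the associate unit ball and
    separates [f] ([norm_le1_of_associate_ball]). *)

(** * Non-negative measurable functions *)

Section positive_cone.
Context (R : realType) (d : measure_display) (T : measurableType d).
Variable mu : {measure set T -> \bar R}.
Local Open Scope ereal_scope.
Implicit Types u v w : T -> \bar R.

Lemma MplusD u v : Mplus u -> Mplus v -> Mplus (fun x => u x + v x).
Proof.
move=> [mu_ u0] [mv v0]; split; first exact: emeasurable_funD.
by move=> x; rewrite adde_ge0.
Qed.

Lemma MplusM u v : Mplus u -> Mplus v -> Mplus (fun x => u x * v x).
Proof.
move=> [mu_ u0] [mv v0]; split; first exact: emeasurable_funM.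
by move=> x; rewrite mule_ge0.
Qed.

Lemma Mplus_min u v : Mplus u -> Mplus v -> Mplus (fun x => mine (u x) (v x)).
Proof.
move=> [mu_ u0] [mv v0]; split; first exact: measurable_mine.
by move=> x; rewrite le_min u0 v0.
Qed.

Lemma Mplus_EFin (f : T -> R) :
  measurable_fun [set: T] f -> (forall x, (0 <= f x)%R) -> Mplus (EFin \o f).
Proof.
by move=> mf f0; split => [|x]; [exact/measurable_EFinP | rewrite lee_fin].
Qed.

Lemma Mplus_cst (a : R) : (0 <= a)%R -> Mplus (fun _ : T => a%:E).
Proof. by move=> a0; exact: (@Mplus_EFin (cst a)). Qed.

Lemma Mplus_indic (E : set T) :
  measurable E -> Mplus (fun x => (\1_E x : R)%:E).
Proof.
by move=> mE; apply: (@Mplus_EFin (\1_E)).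
Qed.

Lemma Mplus_series (v : nat -> T -> \bar R) :
  (forall k, Mplus (v k)) -> Mplus (fun x => \sum_(k <oo) v k x).
Proof.
move=> Mv; split => [|x]; last by apply: nneseries_ge0 => n _ _; case: (Mv n).
apply: (@ge0_emeasurable_sum _ _ _ _ v predT) => [k x _ _|k _]; by case: (Mv k).
Qed.

Lemma Mplus_einfs (v : nat -> T -> \bar R) n :
  (forall k, Mplus (v k)) -> Mplus (fun x => einfs (v^~ x) n).
Proof.
move=> Mv; split => [|x].
  by apply: measurable_fun_einfs => k; case: (Mv k).
by apply: le_ereal_inf_tmp => _ [k _ <-]; case: (Mv k).
Qed.

Lemma Mplus_limn_einf (v : nat -> T -> \bar R) :
  (forall k, Mplus (v k)) -> Mplus (fun x => limn_einf (v^~ x)).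
Proof.
move=> Mv; split=> [|x].
  apply: (emeasurable_fun_cvg (fun n x => einfs (v^~ x) n)) => [m|x _].
    by case: (Mplus_einfs m Mv).
  by rewrite limn_einf_lim; exact: is_cvg_einfs.
rewrite limn_einf_lim; apply: lime_ge; first exact: is_cvg_einfs.
by apply: nearW => n; case: (Mplus_einfs n Mv).
Qed.

Lemma int_ge0 u : Mplus u -> 0 <= \int[mu]_x u x.
Proof. by move=> [_ u0]; exact: integral_ge0. Qed.

Lemma intD u v : Mplus u -> Mplus v ->
  \int[mu]_x (u x + v x) = \int[mu]_x u x + \int[mu]_x v x.
Proof. by move=> [? ?] [? ?]; rewrite ge0_integralD. Qed.

Lemma intZ (a : R) u : (0 <= a)%R -> Mplus u ->
  \int[mu]_x (a%:E * u x) = a%:E * \int[mu]_x u x.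
Proof. by move=> ? [? ?]; rewrite ge0_integralZl// lee_fin. Qed.

Lemma int_le_ae u v : Mplus u -> Mplus v ->
  {ae mu, forall x, u x <= v x} -> \int[mu]_x u x <= \int[mu]_x v x.
Proof.
move=> [? ?] [? ?] uv; apply: ae_ge0_le_integral => //.
by apply: filterS uv => x ux _.
Qed.

Lemma int_le u v : Mplus u -> Mplus v ->
  (forall x, u x <= v x) -> \int[mu]_x u x <= \int[mu]_x v x.
Proof. by move=> ? ? ?; apply: int_le_ae => //; exact: aeW. Qed.

Lemma int_fatou (v : nat -> T -> \bar R) u : (forall k, Mplus (v k)) -> Mplus u ->
  {ae mu, forall x, u x <= limn_einf (v^~ x)} ->
  \int[mu]_x u x <= limn_einf (fun k => \int[mu]_x v k x).
Proof.
move=> Mv Mu uv; apply: le_trans (int_le_ae Mu (Mplus_limn_einf Mv) uv) _.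
by apply: fatou => // k; case: (Mv k).
Qed.

Lemma int_series (v : nat -> T -> \bar R) : (forall k, Mplus (v k)) ->
  \int[mu]_x (\sum_(k <oo) v k x) = \sum_(k <oo) \int[mu]_x v k x.
Proof. by move=> Mv; rewrite integral_nneseries// => n; case: (Mv n). Qed.

Lemma int_fin_ae u : Mplus u -> \int[mu]_x u x < +oo ->
  {ae mu, forall x, u x < +oo}.
Proof.
move=> [mu_ u0] iu.
have iu' : mu.-integrable [set: T] u.
  by apply/integrableP; split=> //; under eq_integral do rewrite gee0_abs//.
apply: filterS (integrable_ae measurableT iu') => x /(_ Logic.I).
by rewrite ge0_fin_numE.
Qed.

Lemma int_eq0_ae u : Mplus u -> \int[mu]_x u x = 0 ->
  {ae mu, forall x, u x = 0}.
Proof.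
move=> [mu_ u0] iu.
have /ae_eq_integral_abs H := mu_; have := (H mu measurableT).1.
under eq_integral do rewrite gee0_abs//.
by move=> /(_ iu); apply: filterS => x /(_ Logic.I).
Qed.

End positive_cone.

(** * Fast convergence and lower limits *)

Section summable.
Context (R : realType).
Local Open Scope ereal_scope.

Definition half_pow (k : nat) : R := ((2 ^ k.+1)%:R^-1)%R.

Lemma half_pow_gt0 k : (0 < half_pow k)%R.
Proof. by rewrite invr_gt0 ltr0n expn_gt0. Qed.

Lemma half_pow_ge0 k : (0 <= half_pow k)%R.
Proof. exact/ltW/half_pow_gt0. Qed.

Lemma half_pow_lt (e : R) : (0 < e)%R -> \forall n \near \oo, (half_pow n < e)%R.
Proof.
move=> e0; near=> n; apply: (@le_lt_trans _ _ n.+1%:R^-1%R); last first.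
  near: n; exact: near_infty_natSinv_lt (PosNum e0).
by rewrite lef_pV2 ?posrE ?ltr0n ?expn_gt0// ler_nat ltnW// ltn_expl.
Unshelve. all: by end_near. Qed.

Lemma half_powS n : (half_pow n.+1 = half_pow n / 2)%R.
Proof. by rewrite /half_pow expnSr natrM invfM. Qed.

Lemma sum_half_pow : \sum_(k <oo) (half_pow k)%:E = 1.
Proof.
have := @cvg_geometric_eseries_half R 1 0; rewrite expr0 divr1 => /cvg_lim <-//.
congr (limn _); apply/funext => n; rewrite /eseries/=.
by apply: eq_bigr => k _; rewrite /half_pow addn1 div1r.
Qed.

Lemma nneseries_term (h : nat -> \bar R) k :
  (forall n, 0 <= h n) -> h k <= \sum_(n <oo) h n.
Proof.
move=> h0; apply: (le_trans _ (nneseries_lim_ge k.+1 _)) => //.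
by rewrite big_nat_recr//= leeDr// sume_ge0.
Qed.

(** The factor [b] may be [+oo]: then both sides are [+oo] as soon as one term
    is positive. *)
Lemma nneseriesMr (a : nat -> \bar R) (b : \bar R) :
  (forall k, 0 <= a k) -> 0 <= b ->
  \sum_(k <oo) a k * b = (\sum_(k <oo) a k) * b.
Proof.
move=> a0; case: b => [b|_|//].
  rewrite lee_fin => b0; rewrite muleC -nneseriesZl//.
  by apply: eq_eseriesr => k _; rewrite muleC.
have [/existsNP[k ak]|/contrapT a_eq0] := pselect (~ forall k, a k = 0).
  have ak0 : 0 < a k by rewrite lt_def a0 andbT; exact/eqP.
  rewrite gt0_muley; last exact: (lt_le_trans ak0 (nneseries_term _ _)).
  apply/eqP; rewrite -leye_eq -[leLHS](gt0_muley ak0).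
  apply: (nneseries_term (h := fun k => a k * +oo)) => n.
  by rewrite mule_ge0// leey.
rewrite !eseries0 ?mul0e// => k _ _; by rewrite a_eq0 ?mul0e.
Qed.

Lemma nneseries_term_cvg0 (h : nat -> \bar R) :
  (forall n, 0 <= h n) -> \sum_(n <oo) h n < +oo -> h n @[n --> \oo] --> 0.
Proof.
move=> h0 hoo.
apply: (squeeze_cvge _ (cvg_cst 0) (nneseries_tail_cvg hoo (fun k _ => h0 k))).
apply: nearW => n; rewrite h0/=.
apply: (le_trans _ (nneseries_lim_ge n.+1 _)) => //.
by rewrite big_nat1.
Qed.

Lemma cvg_of_summable (r : nat -> R) (h : nat -> \bar R) :
  (forall n, (`|r n.+1 - r n|%R)%:E <= h n) -> \sum_(n <oo) h n < +oo ->
  cvgn r.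
Proof.
move=> rh hoo.
have h0 n : 0 <= h n by rewrite (le_trans _ (rh n)) ?lee_fin.
have Sfin : \sum_(n <oo) h n \is a fin_num.
  by rewrite ge0_fin_numE// nneseries_ge0.
have Hc : cvgn [normed series (telescope r)]%R.
  apply: nondecreasing_is_cvgn.
    by apply: nondecreasing_series => n _ _ /=.
  exists (fine (\sum_(n <oo) h n)) => _ [n _ <-].
  rewrite -lee_fin fineK//.
  rewrite (_ : (_ n)%:E = \sum_(0 <= i < n) (`|r i.+1 - r i|%R)%:E); last first.
    by rewrite sumEFin; congr EFin; rewrite /normed_series_of seriesEnat.
  apply: (le_trans _ (nneseries_lim_ge n _)) => //.
  by apply: lee_sum => i _; exact: rh.
have /normed_cvg := Hc; rewrite telescopeK => Hr.
rewrite (_ : r = (fun n => (r n - r 0) + r 0)%R).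
  by apply: is_cvgD => //; exact: is_cvg_cst.
by apply/funext => n; rewrite subrK.
Qed.

End summable.

Section liminf.
Context (R : realType).
Local Open Scope ereal_scope.

Lemma limn_einf_le (a : nat -> \bar R) c :
  (\forall n \near \oo, a n <= c) -> limn_einf a <= c.
Proof.
move=> ac; rewrite limn_einf_lim; apply: lime_le; first exact: is_cvg_einfs.
apply: filterS ac => n; apply: le_trans.
by apply: ereal_inf_lbound; exists n => /=.
Qed.

Lemma limn_einf_ge (a : nat -> \bar R) b :
  (forall c : R, c%:E < b -> \forall n \near \oo, c%:E <= a n) ->
  b <= limn_einf a.
Proof.
move=> ab.
have key (c : R) : c%:E < b -> c%:E <= limn_einf a.
  move=> /ab [m _ ma]; rewrite limn_einf_lim; apply: lime_ge.
    exact: is_cvg_einfs.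
  exists m => // n mn; apply: le_ereal_inf_tmp => _ [k nk <-].
  by apply: ma; exact: leq_trans mn nk.
case: b {ab} key => [b| |] key; last exact: leNye.
  apply/lee_subgt0Pr => e e0; rewrite -EFinB; apply: key.
  by rewrite lte_fin ltrBlDr ltrDl.
by rewrite leye_eq; apply/eqP/eqyP => A _; apply: key; exact: ltry.
Qed.

Lemma le_limn_einf (a b : nat -> \bar R) :
  (forall n, a n <= b n) -> limn_einf a <= limn_einf b.
Proof.
move=> ab; rewrite !limn_einf_lim; apply: lee_lim; [exact: is_cvg_einfs..|].
apply: nearW => n; apply: le_ereal_inf_tmp => _ [k nk <-].
by apply: le_trans (ab k); apply: ereal_inf_lbound; exists k.
Qed.

(** For [b = +oo] the inequality holds because a positive lower limit makes the
    terms eventually positive, so that their products with [b] are [+oo]. *)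
Lemma limn_einfM (a : nat -> \bar R) (b : \bar R) :
  (forall n, 0 <= a n) -> 0 <= b ->
  limn_einf a * b <= limn_einf (fun n => a n * b).
Proof.
move=> a0; case: b => [b|_|//].
  rewrite lee_fin => b0.
  have ea : einfs a n @[n --> \oo] --> limn_einf a.
    by rewrite limn_einf_lim; exact: is_cvg_einfs.
  have eab : einfs a n * b%:E @[n --> \oo] --> limn_einf a * b%:E.
    by apply: cvgeZr.
  rewrite -(cvg_limn_einf_sup eab).1; apply: le_limn_einf => n.
  by rewrite lee_wpmul2r ?lee_fin//; apply: ereal_inf_lbound; exists n => /=.
have [->|L0] := eqVneq (limn_einf a) 0.
  rewrite mul0e; apply: limn_einf_ge => c c0; apply: nearW => n.
  by rewrite (le_trans (ltW c0))// mule_ge0// leey.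
have [[n en]|H] := pselect (exists n, 0 < einfs a n).
  rewrite (le_trans (leey _))//; apply: limn_einf_ge => c _.
  exists n => // m nm; rewrite gt0_muley ?leey//; apply: lt_le_trans en _.
  by apply: ereal_inf_lbound; exists m.
suff L_le0 : limn_einf a <= 0.
  case/negP: L0; rewrite eq_le L_le0/=; apply: limn_einf_ge => c c0.
  by apply: nearW => n; exact: le_trans (ltW c0) (a0 n).
rewrite limn_einf_lim; apply: lime_le; first exact: is_cvg_einfs.
by apply: nearW => n; rewrite leNgt; apply/negP => en; apply: H; exists n.
Qed.

End liminf.

Section ae_limits.
Context (R : realType) (d : measure_display) (T : measurableType d).
Variable mu : {measure set T -> \bar R}.
Local Open Scope ereal_scope.

(** A weighted sum of integrals is the integral of the weighted sum, and an
    integrable function is finite almost everywhere; positivity of the weight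
    transfers finiteness back to the series. *)
Lemma summable_ae (w : T -> R) (h : nat -> T -> \bar R) :
  measurable_fun [set: T] w -> (forall x, (0 < w x)%R) ->
  (forall n, Mplus (h n)) ->
  \sum_(n <oo) \int[mu]_x ((w x)%:E * h n x) < +oo ->
  {ae mu, forall x, \sum_(n <oo) h n x < +oo}.
Proof.
move=> mw w0 Mh.
have Mw : Mplus (EFin \o w) by apply: Mplus_EFin => // x; exact: ltW.
have Mwh n : Mplus (fun x => (w x)%:E * h n x) by exact: (MplusM Mw).
rewrite -int_series// => /(int_fin_ae (Mplus_series Mwh)).
apply: filterS => x; rewrite nneseriesZl; last by move=> n _; case: (Mh n).
by apply: contraTT; rewrite -!leNgt !leye_eq => /eqP ->; rewrite gt0_muley// lte_fin.
Qed.

(** The upper limit is measurable whether or not the sequence converges, so one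
    function serves every point at which the increments are summable. *)
Lemma measurable_limit (r : nat -> T -> R) (h : nat -> T -> \bar R) :
  (forall n, measurable_fun [set: T] (r n)) ->
  (forall n x, (`|r n.+1 x - r n x|%R)%:E <= h n x) ->
  exists2 l : T -> R, measurable_fun [set: T] l &
    forall x, \sum_(n <oo) h n x < +oo -> r^~ x @ \oo --> l x.
Proof.
move=> mr rh; exists (fun x => fine (limn_esup (fun n => (r n x)%:E))).
  apply: measurableT_comp; first exact: fine_measurable.
  by apply: measurable_fun_limn_esup => n; exact/measurable_EFinP.
move=> x hx.
have /cvg_ex[l rl] : cvgn (r^~ x) by exact: (cvg_of_summable (h := h^~ x)).
have rlE : (r n x)%:E @[n --> \oo] --> l%:E by apply: cvg_EFin => //; exact: nearW.
by rewrite (cvg_limn_einf_sup rlE).2.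
Qed.

End ae_limits.

(** * Function norms on the cone and the associate unit ball *)

Section function_norm.
Context (R : realType) (d : measure_display) (T : measurableType d).
Variable mu : {measure set T -> \bar R}.
Variable rho : (T -> ecomplex R) -> \bar R.
Local Open Scope ereal_scope.
Implicit Types u v w : T -> \bar R.

Local Notation N u := (rho (of_Mplus u)).

Lemma of_Mplus_Mfun u : Mplus u -> Mfun (of_Mplus u).
Proof.
move=> [mu_ u0]; split.
- rewrite (_ : [set x | _] = u @^-1` [set +oo]); last first.
    apply/funext => x; apply/propext; rewrite /of_Mplus /=.
    by have := u0 x; case: (u x).
  by rewrite -[X in measurable X]setTI; exact: mu_.
- rewrite (_ : (fun x => _) = fine \o u).
    by apply: measurableT_comp => //; exact: fine_measurable.
  by apply/funext => x; rewrite /of_Mplus/=; case: (u x).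
- rewrite (_ : (fun x => _) = cst 0%R) //.
  by apply/funext => x; rewrite /of_Mplus/=; case: (u x).
Qed.

Lemma ecabs_of_Mplus u : Mplus u -> ecabs (of_Mplus u) = u.
Proof.
move=> [_ u0]; apply/funext => x; rewrite /ecabs /of_Mplus.
have := u0 x; case: (u x) => //= r; rewrite lee_fin => r0.
by rewrite expr0n addr0 sqrtr_sqr ger0_norm.
Qed.

(** Only moduli enter the associate norm, so its unit ball is recorded on the
    cone of non-negative functions. *)
Definition associate_ball : set (T -> \bar R) :=
  [set v | Mplus v /\
    forall w, Mplus w -> N w <= 1 -> \int[mu]_x (v x * w x) <= 1].

(** The integral of the series against [w] is a weighted average of numbers at
    most 1.  Both the positive weight and the gliding hump are such series. *)
Lemma associate_ball_series (v : nat -> T -> \bar R) :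
  (forall k, associate_ball (v k)) ->
  associate_ball (fun x => \sum_(k <oo) (half_pow R k)%:E * v k x).
Proof.
move=> bv.
have Mhv k : Mplus (fun x => (half_pow R k)%:E * v k x).
  by apply: MplusM; [apply/Mplus_cst/half_pow_ge0|case: (bv k)].
split; first exact: Mplus_series.
move=> w Mw w1.
have Mhvw k : Mplus (fun x => (half_pow R k)%:E * (v k x * w x)).
  apply: MplusM; first exact/Mplus_cst/half_pow_ge0.
  by apply: MplusM => //; case: (bv k).
rewrite (_ : \int[mu]_x _ =
    \int[mu]_x \sum_(k <oo) (half_pow R k)%:E * (v k x * w x)); last first.
  apply: eq_integral => x _; rewrite -nneseriesMr.
  - by apply: eq_eseriesr => k _; rewrite muleA.
  - by move=> k; case: (Mhv k).
  - by case: Mw.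
rewrite int_series// -sum_half_pow; apply: lee_nneseries => [k _ _|k _].
  exact: int_ge0.
rewrite intZ ?half_pow_ge0//; last by apply: MplusM => //; case: (bv k).
rewrite -[leRHS]mule1 lee_wpmul2l ?lee_fin ?half_pow_ge0//.
by case: (bv k) => _; apply.
Qed.

Hypothesis bn : banach_function_norm mu rho.

Lemma fnorm_ge0 u : Mplus u -> 0 <= N u.
Proof. by move=> Mu; exact/(bfn_ge0 bn)/of_Mplus_Mfun. Qed.

Lemma fnorm_le u v : Mplus u -> Mplus v -> (forall x, u x <= v x) -> N u <= N v.
Proof. by move=> Mu Mv uv; apply: (bfn_monotone bn) => //; exact: aeW. Qed.

(** The unit ball is closed under almost everywhere convergence: the Fatou axiom
    applies to the increasing sequence of tail infima, each of which lies below a member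
    of the sequence. *)
Lemma fnorm_le_of_liminf (v : nat -> T -> \bar R) u c :
  (forall n, Mplus (v n)) -> Mplus u -> (forall n, N (v n) <= c) ->
  {ae mu, forall x, u x <= limn_einf (v^~ x)} -> N u <= c.
Proof.
move=> Mv Mu vc uv.
have Me n := Mplus_einfs n Mv.
have einf_cvg x : einfs (v^~ x) n @[n --> \oo] --> limn_einf (v^~ x).
  by rewrite limn_einf_lim; exact: is_cvg_einfs.
have ML := Mplus_limn_einf Mv.
apply: (le_trans (bfn_monotone bn Mu ML uv)).
have [_ NL] := bfn_fatou bn Me ML (aeW _ (fun x =>
  conj (fun n => nondecreasing_einfs (v^~ x) (leqnSn n)) (einf_cvg x))).
rewrite -(cvg_lim _ NL)//; apply: lime_le; first by apply/cvg_ex; eexists; exact: NL.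
apply: nearW => n; apply: le_trans (vc n); apply: fnorm_le => // x.
by apply: ereal_inf_lbound; exists n => /=.
Qed.

(** The integral over a set of finite measure is bounded by a multiple of the
    norm, so a multiple of its indicator lies in the associate ball.  The weighted series over a countable cover is positive
    everywhere, and truncating it at 1 makes it real-valued. *)
Lemma positive_associate_weight : sigma_finite [set: T] mu ->
  exists w : T -> R, [/\ measurable_fun [set: T] w, forall x, (0 < w x)%R &
    associate_ball (EFin \o w)].
Proof.
move=> /sigma_finiteP[E [ET _ mE]].
have /choice[C HC] : forall k, exists C : R, (0 < C)%R /\ forall u, Mplus u ->
    \int[mu]_(x in E k) u x <= C%:E * N u.
  move=> k; have [mEk Ekoo] := mE k.
  by have [C C0 HC] := bfn_int bn mEk Ekoo; exists C.
pose v k x := ((C k)^-1)%:E * (\1_(E k) x : R)%:E.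
have Cge0 k : (0 <= (C k)^-1)%R by rewrite invr_ge0; case: (HC k) => /ltW.
have Mv k : Mplus (v k).
  by apply: MplusM; [exact: Mplus_cst|apply: Mplus_indic; case: (mE k)].
have bv k : associate_ball (v k).
  split=> // u Mu u1; have [C0 HCk] := HC k; have [mEk _] := mE k.
  under eq_integral do rewrite /v -muleA.
  rewrite intZ//; last by apply: MplusM => //; exact: Mplus_indic.
  rewrite -[leRHS](_ : ((C k)^-1)%:E * (C k)%:E = 1); last first.
    by rewrite -EFinM mulVf// gt_eqF.
  rewrite lee_wpmul2l ?lee_fin//.
  rewrite (_ : \int[mu]_x _ = \int[mu]_(x in E k) u x).
    by rewrite (le_trans (HCk _ Mu))// -[leRHS]mule1 lee_wpmul2l// lee_fin ltW.
  rewrite [RHS]integral_mkcond; apply: eq_integral => x _.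
  by rewrite patchE indicE; case: ifP => _; rewrite ?mul1e ?mul0e.
have [Ms bs] := associate_ball_series bv.
pose s x := \sum_(k <oo) (half_pow R k)%:E * v k x.
have s_gt0 x : 0 < s x.
  have [k _ Ekx] : (\bigcup_k E k) x by rewrite -ET.
  apply: lt_le_trans (nneseries_term (h := fun k => (half_pow R k)%:E * v k x) k _).
    apply: mule_gt0; rewrite lte_fin ?half_pow_gt0//.
    by rewrite indicE mem_set// mulr1 invr_gt0; case: (HC k).
  move=> n; apply: mule_ge0; first by rewrite lee_fin half_pow_ge0.
  by case: (Mv n).
have Mm : Mplus (fun x => mine (s x) 1) by apply: Mplus_min => //; exact: Mplus_cst.
have sfin x : mine (s x) 1 \is a fin_num.
  by rewrite ge0_fin_numE ?gt_min ?ltry ?orbT//; case: Mm.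
have sE : EFin \o (fun x => fine (mine (s x) 1)) = fun x => mine (s x) 1.
  by apply/funext => x /=; rewrite fineK.
exists (fun x => fine (mine (s x) 1)); split.
- by apply: measurableT_comp; [exact: fine_measurable|case: Mm].
- by move=> x; rewrite -lte_fin fineK// lt_min s_gt0 lte_fin ltr01.
rewrite sE; split=> // u Mu u1; apply: le_trans (bs u Mu u1).
apply: int_le; [exact: MplusM|exact: MplusM|move=> x].
by rewrite lee_wpmul2r ?ge_min ?lexx//; case: Mu.
Qed.

End function_norm.

(** * Nearest points of the unit ball in the square norm *)

Section nearest_point.
Context (R : realType) (d : measure_display) (T : measurableType d).
Variable mu : {measure set T -> \bar R}.
Variable rho : (T -> ecomplex R) -> \bar R.
Hypothesis bn : banach_function_norm mu rho.
Local Open Scope ereal_scope.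

Local Notation N u := (rho (of_Mplus u)).

(** Functions are real-valued here so that differences, and hence the square
    distance, make sense. *)
Definition real_ball : set (T -> R) :=
  [set u : T -> R | [/\ measurable_fun [set: T] u, forall x, (0 <= u x)%R &
    N (EFin \o u) <= 1]].

Definition sqr_dist (f u : T -> R) : \bar R :=
  \int[mu]_x (((f x - u x) ^+ 2)%R)%:E.

Lemma Mplus_sqrB (f u : T -> R) :
  measurable_fun [set: T] f -> measurable_fun [set: T] u ->
  Mplus (fun x => (((f x - u x) ^+ 2)%R)%:E).
Proof.
move=> mf mu_; apply: (@Mplus_EFin _ _ _ (fun x => (f x - u x) ^+ 2)%R) => [|x].
  by apply: measurable_funX; exact: measurable_funB.
exact: sqr_ge0.
Qed.

Lemma real_ball0 : real_ball (cst 0%R).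
Proof.
split=> //; rewrite (_ : N _ = 0) ?lee01//.
by apply/(bfn_eq0 bn); [exact: Mplus_EFin|exact: aeW].
Qed.

Lemma real_ball_convex (t : R) u v : (0 <= t <= 1)%R ->
  real_ball u -> real_ball v ->
  real_ball (fun x => (1 - t) * u x + t * v x)%R.
Proof.
move=> /andP[t0 t1] [mu_ u0 u1] [mv v0 v1].
have t1' : (0 <= 1 - t)%R by rewrite subr_ge0.
have Mu : Mplus (EFin \o u) by exact: Mplus_EFin.
have Mv : Mplus (EFin \o v) by exact: Mplus_EFin.
split.
- by apply: measurable_funD; apply: measurable_funM.
- by move=> x; rewrite addr_ge0// mulr_ge0.
rewrite (_ : EFin \o _ =
  fun x => (1 - t)%:E * (EFin \o u) x + t%:E * (EFin \o v) x)//.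
apply: le_trans (bfn_subadd bn _ _) _; [apply: MplusM => //; exact: Mplus_cst..|].
rewrite !(bfn_homog bn)//.
rewrite (_ : 1 = (1 - t)%:E * 1 + t%:E * 1); last first.
  by rewrite !mule1 -EFinD subrK.
by apply: leeD; apply: lee_wpmul2l; rewrite ?lee_fin.
Qed.

Lemma parallelogram (f u v : T -> R) :
  measurable_fun [set: T] f -> measurable_fun [set: T] u ->
  measurable_fun [set: T] v ->
  sqr_dist u v + 4%:E * sqr_dist f (fun x => (1 - 2^-1) * u x + 2^-1 * v x)%R =
  2%:E * sqr_dist f u + 2%:E * sqr_dist f v.
Proof.
move=> mf mu_ mv.
have mm : measurable_fun [set: T] (fun x => (1 - 2^-1) * u x + 2^-1 * v x)%R.
  by apply: measurable_funD; apply: measurable_funM.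
have Mf (g h : T -> R) (c : R) : (0 <= c)%R -> measurable_fun [set: T] g ->
   measurable_fun [set: T] h -> Mplus (fun x => c%:E * (((g x - h x) ^+ 2)%R)%:E).
  by move=> *; apply: MplusM; [exact: Mplus_cst|exact: Mplus_sqrB].
rewrite /sqr_dist -!intZ//; try exact: Mplus_sqrB.
rewrite -!intD//; [|exact: Mf..|exact: Mplus_sqrB| exact: Mf].
apply: eq_integral => x _; rewrite -!EFinM -!EFinD; congr EFin.
by field.
Qed.

(** The projection onto a closed convex set, as in a Hilbert space: by the
    parallelogram identity and convexity a minimizing sequence has small
    increments in L^2, hence it converges almost everywhere, and the limit is a
    minimizer by Fatou's lemma. *)
Lemma nearest_point (f : T -> R) : measurable_fun [set: T] f ->
  \int[mu]_x (((f x) ^+ 2)%R)%:E < +oo ->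
  exists2 u, real_ball u & forall v, real_ball v -> sqr_dist f u <= sqr_dist f v.
Proof.
move=> mf f2.
pose D := ereal_inf [set sqr_dist f u | u in real_ball].
have D_le v : real_ball v -> D <= sqr_dist f v.
  by move=> bv; apply: ereal_inf_lbound; exists v.
have D_ge0 : 0 <= D.
  by apply: le_ereal_inf_tmp => _ [u [mu_ _ _] <-]; exact/int_ge0/Mplus_sqrB.
have D_fin : D \is a fin_num.
  rewrite ge0_fin_numE//; apply: le_lt_trans (D_le _ real_ball0) _.
  by rewrite /sqr_dist; under eq_integral do rewrite subr0.
(* The excess over the infimum is chosen so that consecutive terms are at square
   distance at most [half_pow n ^ 2]. *)
pose e n := ((half_pow R n) ^+ 2 / 4)%R.
have e_gt0 n : (0 < e n)%R by rewrite divr_gt0// exprn_gt0// half_pow_gt0.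
have /choice[u Hu] : forall n, exists u, real_ball u /\ sqr_dist f u < D + (e n)%:E.
  move=> n; have [_ [u bu <-] uD] := lb_ereal_inf_adherent (e_gt0 n) D_fin.
  by exists u.
have bu n := (Hu n).1; have uD n := ltW (Hu n).2.
have mu_ n : measurable_fun [set: T] (u n) by case: (bu n).
have dist_le n : sqr_dist (u n.+1) (u n) <= ((half_pow R n) ^+ 2)%:E.
  have half01 : (0 <= (2^-1 : R) <= 1)%R by lra.
  have Dm := D_le _ (@real_ball_convex 2^-1 _ _ half01 (bu n.+1) (bu n)).
  have : sqr_dist (u n.+1) (u n) + 4%:E * D <=
      2%:E * (D + (e n.+1)%:E) + 2%:E * (D + (e n)%:E).
    apply: (@le_trans _ _ (sqr_dist (u n.+1) (u n) + 4%:E *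
      sqr_dist f (fun x => (1 - 2^-1) * u n.+1 x + 2^-1 * u n x)%R)).
      by rewrite leeD2l// lee_wpmul2l// ?lee_fin.
    rewrite parallelogram//.
    by apply: leeD; apply: lee_wpmul2l; rewrite ?lee_fin.
  rewrite -(fineK D_fin) /e half_powS; case: (sqr_dist _ _) => [r|//=|_]; last exact: leNye.
  by rewrite -!EFinM -!EFinD !lee_fin; have := sqr_ge0 (half_pow R n); lra.
pose k n x := ((half_pow R n)^-1)%:E * (((u n.+1 x - u n x) ^+ 2)%R)%:E.
have hV0 n : (0 <= (half_pow R n)^-1)%R by rewrite invr_ge0 half_pow_ge0.
have Mk n : Mplus (k n) by apply: MplusM; [exact: Mplus_cst|exact: Mplus_sqrB].
have k_sum : {ae mu, forall x, \sum_(n <oo) k n x < +oo}.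
  apply: (@summable_ae _ _ _ mu (cst 1%R) k) => //.
  apply: (@le_lt_trans _ _ 1); last exact: ltry.
  rewrite -[leRHS](sum_half_pow R); apply: lee_nneseries => [n _ _|n _].
    by apply: int_ge0; apply: MplusM => //; exact: Mplus_cst.
  under eq_integral do rewrite mul1e.
  rewrite intZ//; last exact: Mplus_sqrB.
  apply: le_trans (lee_wpmul2l _ (dist_le n)) _; first by rewrite lee_fin.
  by rewrite -EFinM lee_fin expr2 mulrA mulVf ?mul1r// gt_eqF// half_pow_gt0.
(* Since [|a| <= p + a^2 / p] for [p > 0], summability of the scaled squares
   [k n x] bounds the sum of the increments. *)
pose h n x := (half_pow R n)%:E + k n x.
have h_sum x : \sum_(n <oo) k n x < +oo -> \sum_(n <oo) h n x < +oo.
  move=> kx; rewrite nneseriesD.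
  - by rewrite sum_half_pow lte_add_pinfty ?ltry.
  - by move=> n _ _; rewrite lee_fin half_pow_ge0.
  - by move=> n _ _; case: (Mk n).
have u_h n x : (`|u n.+1 x - u n x|%R)%:E <= h n x.
  rewrite /h /k -EFinM -EFinD lee_fin.
  set a := (u n.+1 x - u n x)%R; have p0 := half_pow_gt0 R n.
  have [a_le|/ltW a_ge] := leP `|a|%R (half_pow R n).
    by rewrite (le_trans a_le)// lerDl mulr_ge0// sqr_ge0.
  apply: (@le_trans _ _ ((half_pow R n)^-1 * a ^+ 2)%R).
    by rewrite mulrC ler_pdivlMr// -real_normK ?num_real// expr2 ler_wpM2l.
  by rewrite lerDr ltW.
have [l ml ul] := measurable_limit mu_ u_h.
pose v x := Num.max (l x) 0%R.
have mv : measurable_fun [set: T] v by exact: measurable_maxr.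
have v0 x : (0 <= v x)%R by rewrite le_max lexx orbT.
have u_v : {ae mu, forall x, u^~ x @ \oo --> v x}.
  apply: filterS k_sum => x /h_sum /ul ulx; rewrite /v max_l//.
  rewrite -(cvg_lim _ ulx)//; apply: limr_ge; first exact: cvgP ulx.
  by apply: nearW => n; case: (bu n).
have bv : real_ball v.
  split=> //; apply: (@fnorm_le_of_liminf _ _ _ _ _ bn (fun n => EFin \o u n)).
  - by move=> n; apply: Mplus_EFin => //; case: (bu n).
  - exact: Mplus_EFin.
  - by move=> n; case: (bu n).
  - apply: filterS u_v => x ux /=.
    have uxE : (u n x)%:E @[n --> \oo] --> (v x)%:E by apply: cvg_EFin => //; exact: nearW.
    by rewrite (cvg_limn_einf_sup uxE).1.
exists v => // w bw; apply: le_trans (D_le _ bw).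
have M2 n := Mplus_sqrB mf (mu_ n).
apply: le_trans (int_fatou M2 (Mplus_sqrB mf mv) _) _.
  apply: filterS u_v => x ux.
  have uxE : (((f x - u n x) ^+ 2)%R)%:E @[n --> \oo] --> (((f x - v x) ^+ 2)%R)%:E.
    apply: cvg_EFin; first exact: nearW.
    by apply: cvgM; apply: cvgB => //; exact: cvg_cst.
  by rewrite (cvg_limn_einf_sup uxE).1.
apply/lee_addgt0Pr => eps eps0; apply: limn_einf_le.
have := half_pow_lt eps0; apply: filterS => n pn.
apply: le_trans (uD n) _; rewrite leeD2l// lee_fin (le_trans _ (ltW pn))//.
rewrite /e; have := half_pow_gt0 R n.
have : (half_pow R n <= 1)%R.
  by rewrite invf_le1 ?ler1n ?ltr0n ?expn_gt0.
by nra.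
Qed.
End nearest_point.

(** * Separation from the unit ball *)

(** The step in the variational inequality where [t] tends to 0. *)
Lemma le_of_quadratic (R : realFieldType) (a b k : R) : 0 <= k ->
  (forall t, 0 <= t <= 1 -> 2 * t * b <= 2 * t * a + t ^+ 2 * k) -> b <= a.
Proof.
move=> k0 H; rewrite leNgt; apply/negP => ab.
have ba : 0 < b - a by rewrite subr_gt0.
have kba : 0 < k + (b - a) by lra.
(* For this [t] one has [t k < b - a], so that [t^2 k] stays below the linear
   gain [2 t (b - a)]. *)
pose t := (b - a) / (k + (b - a)).
have t0 : 0 < t by rewrite divr_gt0.
have t1 : t <= 1 by rewrite ler_pdivrMr//; lra.
have tE : t * k = (b - a) - t * (b - a) by rewrite /t; field; lra.
have := H t; rewrite (ltW t0) t1 => /(_ isT).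
have -> : t ^+ 2 * k = t * ((b - a) - t * (b - a)) by rewrite -tE; ring.
by have := mulr_gt0 t0 (mulr_gt0 t0 ba); have := mulr_gt0 t0 ba; nra.
Qed.

Section separation.
Context (R : realType) (d : measure_display) (T : measurableType d).
Variable mu : {measure set T -> \bar R}.
Variable rho : (T -> ecomplex R) -> \bar R.
Hypothesis bn : banach_function_norm mu rho.
Local Open Scope ereal_scope.

Local Notation N u := (rho (of_Mplus u)).

Lemma int_EFin_fin (p q : T -> R) (c : R) :
  measurable_fun [set: T] p -> measurable_fun [set: T] q ->
  (forall x, 0 <= p x <= c * q x)%R -> (0 <= c)%R -> (forall x, 0 <= q x)%R ->
  \int[mu]_x (q x)%:E < +oo -> \int[mu]_x (p x)%:E \is a fin_num.
Proof.
move=> mp mq pq c0 q0 qoo.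
have Mp : Mplus (EFin \o p) by apply: Mplus_EFin => // x; case/andP: (pq x).
have Mq : Mplus (EFin \o q) by exact: Mplus_EFin.
rewrite ge0_fin_numE; last exact: (int_ge0 mu Mp).
apply: (@le_lt_trans _ _ (\int[mu]_x (c%:E * (EFin \o q) x))).
  apply: (int_le mu Mp); first by apply: MplusM => //; exact: Mplus_cst.
  by move=> x; rewrite /= lee_fin; case/andP: (pq x).
by rewrite intZ// lte_mul_pinfty.
Qed.

(** The segment from the nearest point [u] to [v] stays in the ball, so the square
    distance to [f] is non-decreasing at [u] along it.  The bound of [v] by a
    multiple of [f] makes every integral finite. *)
Lemma variational_inequality (f u v : T -> R) (c : R) :
  measurable_fun [set: T] f -> (forall x, 0 <= f x)%R ->
  \int[mu]_x (((f x) ^+ 2)%R)%:E < +oo ->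
  real_ball rho u -> (forall x, u x <= f x)%R ->
  (forall w, real_ball rho w -> sqr_dist mu f u <= sqr_dist mu f w) ->
  real_ball rho v -> (0 <= c)%R -> (forall x, v x <= c * f x)%R ->
  \int[mu]_x ((f x - u x) * v x)%:E <= \int[mu]_x ((f x - u x) * u x)%:E.
Proof.
move=> mf f0 f2 bu uf umin bv c0 vf.
have [mu_ u0 _] := bu; have [mv v0 _] := bv.
have mg : measurable_fun [set: T] (fun x => f x - u x)%R by exact: measurable_funB.
have mgu : measurable_fun [set: T] (fun x => (f x - u x) * u x)%R.
  exact: measurable_funM.
have mgv : measurable_fun [set: T] (fun x => (f x - u x) * v x)%R.
  exact: measurable_funM.
have mf2 : measurable_fun [set: T] (fun x => f x ^+ 2)%R by exact: measurable_funX.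
have mvu : measurable_fun [set: T] (fun x => (v x - u x) ^+ 2)%R.
  by apply: measurable_funX; exact: measurable_funB.
have mg2 : measurable_fun [set: T] (fun x => (f x - u x) ^+ 2)%R.
  exact: measurable_funX.
have f20 x : (0 <= f x ^+ 2)%R by exact: sqr_ge0.
have finu : \int[mu]_x ((f x - u x) * u x)%:E \is a fin_num.
  apply: (int_EFin_fin (c := 1%R) mgu mf2) => // x.
  by have := f0 x; have := u0 x; have := uf x; nra.
have finv : \int[mu]_x ((f x - u x) * v x)%:E \is a fin_num.
  apply: (int_EFin_fin (c := c) mgv mf2) => // x.
  have := f0 x; have := u0 x; have := uf x; have := vf x; have := v0 x.
  move=> ? ? ? ? ?; rewrite mulr_ge0 ?subr_ge0//=.
  by rewrite expr2 mulrCA ler_pM ?subr_ge0//; lra.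
have fing : sqr_dist mu f u \is a fin_num.
  apply: (int_EFin_fin (c := 1%R) mg2 mf2) => // x.
  by have := f0 x; have := u0 x; have := uf x; nra.
have finvu : sqr_dist mu v u \is a fin_num.
  apply: (int_EFin_fin (c := (1 + c ^+ 2)%R) mvu mf2) => //; last first.
    by have := sqr_ge0 c; lra.
  move=> x; have := f0 x; have := u0 x; have := uf x; have := vf x; have := v0 x.
  move=> ? ? ? ? ?; rewrite sqr_ge0/=.
  have : (v x ^+ 2 <= (c * f x) ^+ 2)%R by rewrite ler_pXn2r// nnegrE mulr_ge0.
  have : (u x ^+ 2 <= f x ^+ 2)%R by rewrite ler_pXn2r.
  have : (0 <= u x * v x)%R by rewrite mulr_ge0.
  by rewrite sqrrB exprMn; lra.
rewrite -(fineK finu) -(fineK finv) lee_fin.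
apply: (@le_of_quadratic _ _ _ (fine (sqr_dist mu v u))) => [|t t01].
  by rewrite fine_ge0//; exact/int_ge0/Mplus_sqrB.
have [t0 t1] := andP t01.
have bw := real_ball_convex bn t01 bu bv; have [mw _ _] := bw.
have M1 := Mplus_sqrB mf mu_; have M2 := Mplus_sqrB mf mw.
have M3 := Mplus_sqrB mv mu_.
have Mgu : Mplus (fun x => ((f x - u x) * u x)%:E).
  by apply: (Mplus_EFin mgu) => x; rewrite mulr_ge0// subr_ge0.
have Mgv : Mplus (fun x => ((f x - u x) * v x)%:E).
  by apply: (Mplus_EFin mgv) => x; rewrite mulr_ge0// subr_ge0.
have MZ (a : R) p : (0 <= a)%R -> Mplus p -> Mplus (fun x : T => a%:E * p x).
  by move=> ? ?; apply: MplusM => //; exact: Mplus_cst.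
have t20 : (0 <= 2 * t)%R by rewrite mulr_ge0.
have tt0 : (0 <= t ^+ 2)%R by exact: sqr_ge0.
(* Both sides are arranged to be sums of non-negative terms, so that the
   integral is additive on them. *)
have expand : sqr_dist mu f u + ((2 * t)%:E * \int[mu]_x ((f x - u x) * u x)%:E
      + (t ^+ 2)%:E * sqr_dist mu v u) =
    sqr_dist mu f (fun x => (1 - t) * u x + t * v x)%R +
      (2 * t)%:E * \int[mu]_x ((f x - u x) * v x)%:E.
  rewrite /sqr_dist -!intZ// -!intD//; try exact: MZ; last first.
    by apply: MplusD; exact: MZ.
  by apply: eq_integral => x _; rewrite -!EFinM -!EFinD; congr EFin; ring.
have : sqr_dist mu f u + (2 * t)%:E * \int[mu]_x ((f x - u x) * v x)%:E <=
  sqr_dist mu f u + ((2 * t)%:E * \int[mu]_x ((f x - u x) * u x)%:E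
      + (t ^+ 2)%:E * sqr_dist mu v u).
  by rewrite expand leeD2r// umin.
rewrite leeD2lE//.
by rewrite -[in X in X -> _](fineK finu) -[in X in X -> _](fineK finv) -[in X in X -> _](fineK finvu) -!EFinM -!EFinD lee_fin.
Qed.

(** If the norm of [f] exceeded 1, the difference [g] between [f] and its nearest
    point [u] in the unit ball would, after division by [int g u], be an element
    of the associate ball whose integral against [f] exceeds 1. *)
Lemma norm_le1_of_associate_ball (f : T -> R) :
  measurable_fun [set: T] f -> (forall x, 0 <= f x)%R ->
  \int[mu]_x (((f x) ^+ 2)%R)%:E < +oo -> N (EFin \o f) < +oo ->
  (forall v, associate_ball mu rho v -> \int[mu]_x ((f x)%:E * v x) <= 1) ->
  N (EFin \o f) <= 1.
Proof.
move=> mf f0 f2 Nfoo Hf; rewrite leNgt; apply/negP => Nf1.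
have Mf : Mplus (EFin \o f) by exact: Mplus_EFin.
have [u' bu' u'min] := nearest_point bn mf f2.
have [mu'_ u'0 Nu'] := bu'.
(* Cutting the nearest point at [f] does not increase the distance and makes
   [f - u] non-negative. *)
pose u x := Num.min (u' x) (f x).
have mu_ : measurable_fun [set: T] u by exact: measurable_minr.
have u0 x : (0 <= u x)%R by rewrite le_min u'0 f0.
have uf x : (u x <= f x)%R by rewrite ge_min lexx orbT.
have Mu : Mplus (EFin \o u) by exact: Mplus_EFin.
have bu : real_ball rho u.
  split=> //; apply: le_trans Nu'; apply: (fnorm_le bn) => //; first exact: Mplus_EFin.
  by move=> x; rewrite lee_fin ge_min lexx.
have umin w : real_ball rho w -> sqr_dist mu f u <= sqr_dist mu f w.
  move=> bw; apply: le_trans (u'min w bw).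
  apply: int_le; [exact: Mplus_sqrB..|move=> x].
  rewrite lee_fin /u; case: (leP (u' x) (f x)) => // _.
  by rewrite subrr expr0n sqr_ge0.
pose g x := (f x - u x)%R.
have mg : measurable_fun [set: T] g by exact: measurable_funB.
have g0 x : (0 <= g x)%R by rewrite subr_ge0.
have Mg : Mplus (EFin \o g) by exact: Mplus_EFin.
have mf2 : measurable_fun [set: T] (fun x => f x ^+ 2)%R by exact: measurable_funX.
have f20 x : (0 <= f x ^+ 2)%R by exact: sqr_ge0.
pose a := \int[mu]_x (g x * u x)%:E.
have a_fin : a \is a fin_num.
  apply: (int_EFin_fin (c := 1%R) _ mf2) => //; first exact: measurable_funM.
  by move=> x; rewrite /g; have := f0 x; have := u0 x; have := uf x; nra.
have a_max w : Mplus w -> N w <= 1 -> \int[mu]_x ((g x)%:E * w x) <= a.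
  move=> Mw w1.
  (* The variational inequality needs multiples of [f] as bounds; the truncations
     exhaust [w] where [f > 0], and elsewhere [g] vanishes. *)
  pose v n x := fine (mine (w x) (n%:R * f x)%:E).
  have Mv n : Mplus (fun x => mine (w x) (n%:R * f x)%:E).
    apply: Mplus_min => //; apply: (@Mplus_EFin _ _ _ (fun x => n%:R * f x)%R).
      exact: measurable_funM.
    by move=> x; rewrite mulr_ge0.
  have vE n x : (v n x)%:E = mine (w x) (n%:R * f x)%:E.
    rewrite fineK// ge0_fin_numE ?gt_min ?ltry ?orbT//.
    by case: (Mv n).
  have bv n : real_ball rho (v n).
    split.
    - by apply: measurableT_comp; [exact: fine_measurable|case: (Mv n)].
    - by move=> x; rewrite -lee_fin vE; case: (Mv n).
    - apply: le_trans w1; rewrite (_ : EFin \o v n = fun x => mine (w x) (n%:R * f x)%:E).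
        by apply: (fnorm_le bn) => // x; rewrite ge_min lexx.
      by apply/funext => x; rewrite /= vE.
  have Mgv n : Mplus (fun x => (g x * v n x)%:E).
    have [mv v0 _] := bv n.
    apply: (@Mplus_EFin _ _ _ (fun x => g x * v n x)%R).
      exact: measurable_funM.
    by move=> x; rewrite mulr_ge0.
  apply: (@le_trans _ _ (limn_einf (fun n => \int[mu]_x (g x * v n x)%:E))).
    apply: int_fatou => //; first exact: MplusM.
    apply: aeW => x.
    have [fx0|fx0] := eqVneq (f x) 0%R.
      have -> : g x = 0%R by apply/eqP; rewrite eq_le g0 /g fx0 sub0r oppr_le0 u0.
      by rewrite mul0e; apply: limn_einf_ge => c c0; apply: nearW => n;
        rewrite mul0r ltW.
    rewrite muleC; apply: (@le_trans _ _ (limn_einf (fun n => (v n x)%:E) * (g x)%:E)).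
      rewrite lee_wpmul2r ?lee_fin//; apply: limn_einf_ge => c cw.
      have [m cm] : exists m : nat, (c / f x <= m%:R)%R.
        by exists (Num.truncn (c / f x)).+1; exact/ltW/truncnS_gt.
      exists m => // n /= mn; rewrite vE le_min (ltW cw) lee_fin.
      rewrite -ler_pdivrMr ?lt_def ?fx0 ?f0//.
      by rewrite (le_trans cm)// ler_nat.
    apply: le_trans (limn_einfM _ _) _.
    + by move=> n; rewrite vE; case: (Mv n).
    + by rewrite lee_fin.
    + by apply: le_limn_einf => n; rewrite -EFinM mulrC.
  apply: limn_einf_le; apply: nearW => n.
  apply: (variational_inequality mf f0 f2 bu uf umin (bv n) (ler0n _ n)) => x.
  by rewrite -lee_fin vE ge_min lexx orbT.
have Mg2 : Mplus (fun x => (g x ^+ 2)%:E).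
  by apply: (@Mplus_EFin _ _ _ (fun x => g x ^+ 2)%R) => [|x];
    [exact: measurable_funX|exact: sqr_ge0].
have Mgu : Mplus (fun x => (g x * u x)%:E).
  by apply: (@Mplus_EFin _ _ _ (fun x => g x * u x)%R) => [|x];
    [exact: measurable_funM|rewrite mulr_ge0].
pose G := \int[mu]_x (g x ^+ 2)%:E.
have gfE : \int[mu]_x ((g x)%:E * (f x)%:E) = G + a.
  rewrite /G /a -intD//; apply: eq_integral => x _.
  by rewrite -EFinM -EFinD; congr EFin; rewrite /g; ring.
have G0 : 0 < G.
  rewrite lt_def int_ge0// andbT; apply/eqP => /(int_eq0_ae Mg2) g_eq0.
  move: Nf1; apply/negP; rewrite -leNgt.
  have [_ _] := bu; apply: le_trans; apply: (bfn_monotone bn) => //.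
  apply: filterS g_eq0 => x /= [] /eqP; rewrite expf_eq0/= /g subr_eq0 => /eqP ->.
  exact: lexx.
(* The normalization of [f] lies in the ball and has a positive integral
   against [g]. *)
have a0 : (0 < fine a)%R.
  have Nf_fin : N (EFin \o f) \is a fin_num by rewrite ge0_fin_numE ?(fnorm_ge0 bn).
  have [s s0 sE] : exists2 s : R, (0 < s)%R & N (EFin \o f) = s%:E.
    exists (fine (N (EFin \o f))); last by rewrite fineK.
    by rewrite fine_gt0// Nfoo (lt_trans _ Nf1).
  have sV : (0 <= s^-1)%R by rewrite invr_ge0 ltW.
  have := a_max (fun x => (s^-1)%:E * (f x)%:E).
  rewrite (bfn_homog bn (u := EFin \o f))// sE -EFinM mulVf ?gt_eqF// lexx.
  have -> : Mplus (fun x => (s^-1)%:E * (f x)%:E) = True.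
    by apply/propT/(MplusM _ Mf)/Mplus_cst.
  move=> /(_ Logic.I isT).
  under eq_integral do rewrite muleCA.
  rewrite (intZ mu sV (MplusM Mg Mf))/= gfE => H.
  rewrite -lte_fin fineK//; apply: lt_le_trans H.
  apply: mule_gt0; first by rewrite lte_fin invr_gt0.
  by apply: (lt_le_trans G0); rewrite leeDl// int_ge0.
have aV : (0 <= (fine a)^-1)%R by rewrite invr_ge0 ltW.
have /Hf : associate_ball mu rho (fun x => ((fine a)^-1)%:E * (g x)%:E).
  split; first by apply: MplusM => //; exact: Mplus_cst.
  move=> w Mw w1; under eq_integral do rewrite -muleA.
  rewrite (intZ mu aV (MplusM Mg Mw))/=.
  apply: le_trans (lee_wpmul2l _ (a_max w Mw w1)) _; first by rewrite lee_fin.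
  by rewrite -(fineK a_fin) -EFinM fineK// lee_fin mulVf// gt_eqF.
have -> : \int[mu]_x ((f x)%:E * (((fine a)^-1)%:E * (g x)%:E)) =
    ((fine a)^-1)%:E * (G + a).
  rewrite -gfE -intZ//; last exact: (MplusM Mg Mf).
  by apply: eq_integral => x _; rewrite muleCA [((g x)%:E * _)%E]muleC.
rewrite -[X in _ * (_ + X)](fineK a_fin); apply/negP; rewrite -ltNge.
move: G0; move: (G) => [h| |]// h0.
  rewrite -EFinD -EFinM lte_fin mulrC ltr_pdivlMr// mul1r ltrDr.
  by rewrite -lte_fin.
by rewrite addye// gt0_muley ?ltry// lte_fin invr_gt0.
Qed.
End separation.

(** * Finiteness of the second associate norm implies finiteness of the norm *)

Section lorentz_luxemburg.
Context (R : realType) (d : measure_display) (T : measurableType d).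
Variable mu : {measure set T -> \bar R}.
Variable rho : (T -> ecomplex R) -> \bar R.
Hypothesis bn : banach_function_norm mu rho.
Local Open Scope ereal_scope.

Local Notation N u := (rho (of_Mplus u)).

Lemma norm_le_of_associate_ball (f : T -> R) (c : R) : (0 < c)%R ->
  measurable_fun [set: T] f -> (forall x, 0 <= f x)%R ->
  \int[mu]_x (((f x) ^+ 2)%R)%:E < +oo -> N (EFin \o f) < +oo ->
  (forall v, associate_ball mu rho v -> \int[mu]_x ((f x)%:E * v x) <= c%:E) ->
  N (EFin \o f) <= c%:E.
Proof.
move=> c0 mf f0 f2 Nfoo Hf.
have Mf : Mplus (EFin \o f) by exact: Mplus_EFin.
have cV : (0 <= c^-1)%R by rewrite invr_ge0 ltW.
pose g x := (c^-1 * f x)%R.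
have gE : EFin \o g = fun x => (c^-1)%:E * (EFin \o f) x by [].
have NgE : N (EFin \o g) = (c^-1)%:E * N (EFin \o f) by rewrite gE (bfn_homog bn).
have mg : measurable_fun [set: T] g by exact: measurable_funM.
have g0 x : (0 <= g x)%R by rewrite mulr_ge0.
have f2M : Mplus (fun x => (f x ^+ 2)%:E).
  by apply: (@Mplus_EFin _ _ _ (fun x => f x ^+ 2)%R) => [|x];
    [exact: measurable_funX|exact: sqr_ge0].
have : N (EFin \o g) <= 1.
  apply: (norm_le1_of_associate_ball bn) => //.
  - rewrite (_ : \int[mu]_x _ = \int[mu]_x ((c^-1 ^+ 2)%:E * (f x ^+ 2)%:E)).
      by rewrite intZ ?sqr_ge0// lte_mul_pinfty ?lee_fin ?sqr_ge0// int_ge0.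
    by apply: eq_integral => x _; rewrite -EFinM -exprMn.
  - by rewrite NgE lte_mul_pinfty// ?(fnorm_ge0 bn)// ge0_fin_numE ?(fnorm_ge0 bn).
  - move=> v bv; have [Mv _] := bv.
    under eq_integral do rewrite EFinM -muleA.
    rewrite (intZ mu cV (MplusM Mf Mv))/=.
    apply: le_trans (lee_wpmul2l _ (Hf v bv)) _; first by rewrite lee_fin.
    by rewrite -EFinM mulVf// gt_eqF.
rewrite NgE => /(@lee_wpmul2l _ c%:E); rewrite lee_fin ltW// => /(_ isT).
by rewrite muleA -EFinM divff ?gt_eqF// mul1e mule1.
Qed.

(** Gliding hump: if [v k] in the ball had integrals against [u] growing faster
    than the weights decay, their weighted series would be an element of the ball
    whose integral against [u] is infinite. *)
Lemma uniform_bound_on_associate_ball u : Mplus u ->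
  (forall v, associate_ball mu rho v -> \int[mu]_x (u x * v x) < +oo) ->
  exists2 c : R, (0 < c)%R &
    forall v, associate_ball mu rho v -> \int[mu]_x (u x * v x) <= c%:E.
Proof.
move=> Mu uoo; apply: contrapT => H.
have /choice[v Hv] : forall k : nat, exists v, associate_ball mu rho v /\
    (k.+1%:R / half_pow R k)%:E < \int[mu]_x (u x * v x).
  move=> k; apply: contrapT => H'; apply: H.
  exists (k.+1%:R / half_pow R k)%R; first by rewrite divr_gt0// half_pow_gt0.
  by move=> v bv; rewrite leNgt; apply/negP => vk; apply: H'; exists v.
have bv k := (Hv k).1.
have Mv k : Mplus (v k) by case: (bv k).
have Mhv k : Mplus (fun x => (half_pow R k)%:E * v k x).
  by apply: MplusM => //; exact/Mplus_cst/half_pow_ge0.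
have bs := associate_ball_series bv; have [Ms _] := bs.
have := uoo _ bs; apply/negP; rewrite -leNgt leye_eq; apply/eqP/eqyP => A A0.
pose k := Num.truncn A.
apply: (@le_trans _ _ (k.+1%:R%:E)).
  by rewrite lee_fin; exact/ltW/truncnS_gt.
apply: (@le_trans _ _ (\int[mu]_x ((half_pow R k)%:E * (u x * v k x)))).
  rewrite intZ ?half_pow_ge0//; last exact: MplusM.
  rewrite (_ : k.+1%:R%:E = (half_pow R k)%:E * (k.+1%:R / half_pow R k)%:E).
    by rewrite lee_wpmul2l ?lee_fin ?half_pow_ge0//; exact/ltW/(Hv k).2.
  by rewrite -EFinM mulrCA divff ?mulr1// gt_eqF// half_pow_gt0.
apply: int_le.
- by apply: MplusM; [exact/Mplus_cst/half_pow_ge0|exact: MplusM].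
- exact: MplusM.
- move=> x; rewrite muleCA lee_wpmul2l//; first by case: Mu.
  apply: (nneseries_term (h := fun k => (half_pow R k)%:E * v k x)) => n.
  by case: (Mhv n).
Qed.

(** The Lorentz-Luxemburg theorem in qualitative form.  The truncations
    [min (u, n)] on sets of finite measure are square integrable and have finite
    norm, so separation bounds their norms by the uniform bound, and the
    Fatou property passes this bound to [u]. *)
Lemma norm_lt_pinfty_of_associate_ball u : sigma_finite [set: T] mu ->
  Mplus u ->
  (forall v, associate_ball mu rho v -> \int[mu]_x (u x * v x) < +oo) ->
  N u < +oo.
Proof.
move=> /sigma_finiteP[E [ET ndE mE]] Mu uoo.
have [c c0 uc] := uniform_bound_on_associate_ball Mu uoo.
have mEn n : measurable (E n) by case: (mE n).
have Mind n : Mplus (fun x => (\1_(E n) x : R)%:E) by exact: Mplus_indic.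
pose t n x := mine (u x) (n%:R%:E).
have Mt n : Mplus (t n) by apply: Mplus_min => //; exact: Mplus_cst.
have t_fin n x : t n x \is a fin_num.
  by rewrite ge0_fin_numE; [rewrite gt_min ltry orbT|case: (Mt n)].
pose f n x := (fine (t n x) * \1_(E n) x)%R.
have t0 n x : (0 <= fine (t n x))%R by rewrite fine_ge0//; case: (Mt n).
have tn n x : (fine (t n x) <= n%:R)%R by rewrite -lee_fin fineK// ge_min lexx orbT.
have ind0 n x : (0 <= \1_(E n) x :> R)%R by rewrite indicE.
have ind1 n x : (\1_(E n) x <= 1 :> R)%R by rewrite indicE lern1 leq_b1.
have mf n : measurable_fun [set: T] (f n).
  apply: measurable_funM; last by have [/measurable_EFinP] := Mind n.
  by apply: measurableT_comp; [exact: fine_measurable|case: (Mt n)].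
have f0 n x : (0 <= f n x)%R by rewrite mulr_ge0.
have Mf n : Mplus (EFin \o f n) by exact: Mplus_EFin.
have f_u n x : (f n x)%:E <= u x.
  apply: (@le_trans _ _ (t n x)); last by rewrite ge_min lexx.
  by rewrite -(fineK (t_fin n x)) lee_fin ler_piMr.
apply: (@le_lt_trans _ _ c%:E); last exact: ltry.
apply: (fnorm_le_of_liminf bn (v := fun n => EFin \o f n)) => // [n|].
  have f_le x : (f n x <= n%:R * \1_(E n) x)%R by rewrite ler_wpM2r.
  apply: norm_le_of_associate_ball => //.
  - apply: (@le_lt_trans _ _ (\int[mu]_x ((n%:R ^+ 2)%:E * (\1_(E n) x : R)%:E))).
      apply: int_le.
      + by apply: (@Mplus_EFin _ _ _ (fun x => f n x ^+ 2)%R) => [|x];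
          [exact: measurable_funX|exact: sqr_ge0].
      + by apply: MplusM => //; apply: Mplus_cst; exact: sqr_ge0.
      + move=> x; rewrite -EFinM lee_fin.
        apply: (@le_trans _ _ ((n%:R * \1_(E n) x) ^+ 2)%R).
          by rewrite ler_pXn2r// nnegrE// mulr_ge0.
        by rewrite exprMn ler_wpM2l ?sqr_ge0// expr2 ler_piMr.
    rewrite intZ ?sqr_ge0// integral_indic// setIT.
    by rewrite lte_mul_pinfty ?lee_fin ?sqr_ge0//; case: (mE n).
  - apply: (@le_lt_trans _ _ (N (fun x => n%:R%:E * (\1_(E n) x : R)%:E))).
      apply: (fnorm_le bn) => //.
      by apply: MplusM => //; exact: Mplus_cst.
    rewrite (bfn_homog bn)// lte_mul_pinfty ?lee_fin//.
    by apply: (bfn_indic bn) => //; case: (mE n).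
  - move=> v bv; have [Mv _] := bv; apply: le_trans (uc v bv).
    apply: int_le; [exact: (MplusM (Mf n) Mv)|exact: MplusM|move=> x].
    by rewrite lee_wpmul2r//; case: Mv.
apply: aeW => x; apply: limn_einf_ge => b bu.
have [m _ Emx] : (\bigcup_k E k) x by rewrite -ET.
exists (maxn m (Num.truncn b).+1) => // n /=; rewrite geq_max => /andP[mn bn'].
have Enx : E n x by move/subsetPset: (ndE _ _ mn); apply.
rewrite /f indicE mem_set// mulr1 fineK// le_min ltW//= lee_fin.
by rewrite (le_trans (ltW (truncnS_gt b)))// ler_nat.
Qed.

End lorentz_luxemburg.

(** * Extended complex functions *)

Section extended_complex.
Context (R : realType).
Local Open Scope ereal_scope.
Implicit Types z w v : ecomplex R.

Lemma ec_abs_ge0 z : 0 <= ec_abs z.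
Proof. by case: z => [[a b]|] //=; rewrite lee_fin sqrtr_ge0. Qed.

Lemma ec_sub0 z : ec_sub z (Some 0%R) = z.
Proof. by case: z => //= c; rewrite subr0. Qed.

Lemma ec_abs_subC z w : ec_abs (ec_sub z w) = ec_abs (ec_sub w z).
Proof. by case: z w => [a|] [b|]//=; rewrite -opprB normcN. Qed.

(** If one of the points is at infinity, the right-hand side is infinite. *)
Lemma ec_abs_triangle z w v :
  ec_abs (ec_sub z w) <= ec_abs (ec_sub z v) + ec_abs (ec_sub v w).
Proof.
have abs_gtNy (u : ecomplex R) : ec_abs u != -oo.
  by rewrite gt_eqF// (lt_le_trans _ (ec_abs_ge0 u)).
case: v => [c|]; last first.
  by case: z w => [a|] [b|]; rewrite //= ?addye ?leey.
case: z => [a|]; last by rewrite /= addye ?leey.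
case: w => [b|]; last by rewrite /= addey ?leey.
rewrite /= -EFinD lee_fin (_ : a - b = (a - c) + (c - b))%R; last by rewrite addrA subrK.
exact: le_normcD.
Qed.

Lemma ec_Re_le z w : (`|ec_Re z - ec_Re w|%R)%:E <= ec_abs (ec_sub z w).
Proof.
case: z w => [[a b]|] [[a' b']|]; rewrite ?leey//= lee_fin -sqrtr_sqr.
by rewrite ler_wsqrtr// lerDl sqr_ge0.
Qed.

Lemma ec_Im_le z w : (`|ec_Im z - ec_Im w|%R)%:E <= ec_abs (ec_sub z w).
Proof.
case: z w => [[a b]|] [[a' b']|]; rewrite ?leey//= lee_fin -sqrtr_sqr.
by rewrite ler_wsqrtr// lerDr sqr_ge0.
Qed.

Lemma ec_abs_sub_le (z : R[i]) (w : R[i]) :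
  ec_abs (ec_sub (Some z) (Some w)) <=
  (`|complex.Re z - complex.Re w| + `|complex.Im z - complex.Im w|)%R%:E.
Proof.
case: z w => [a b] [a' b'] /=; rewrite lee_fin.
rewrite -[leRHS]ger0_norm ?addr_ge0// -sqrtr_sqr ler_wsqrtr//.
rewrite [leRHS]sqrrD !real_normK ?num_real// lerD2r lerDl mulrn_wge0//.
Qed.

(** A formula in which every term is visibly a measurable function. *)
Lemma ec_absE z :
  ec_abs z = (Num.sqrt (ec_Re z ^+ 2 + ec_Im z ^+ 2))%:E +
             (+oo * (z == None)%:R%:E).
Proof.
case: z => [[a b]|] /=; first by rewrite mule0 adde0.
by rewrite expr0n addr0 sqrtr0 mule1 add0e.
Qed.

End extended_complex.

Section Mfun_closure.
Context (R : realType) (d : measure_display) (T : measurableType d).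
Local Open Scope ereal_scope.
Implicit Types f g : T -> ecomplex R.

Lemma indic_None f x : (\1_[set x | f x = None] x = (f x == None)%:R :> R)%R.
Proof. by rewrite indicE; congr (nat_of_bool _)%:R; apply/idP/eqP; rewrite inE. Qed.

Lemma Mfun_ecabs f : Mfun f -> Mplus (ecabs f).
Proof.
move=> [mN mR mI]; split=> [|x]; last exact: ec_abs_ge0.
rewrite (_ : ecabs f = fun x =>
  (Num.sqrt (ec_Re (f x) ^+ 2 + ec_Im (f x) ^+ 2))%:E +
     (+oo * (\1_[set x | f x = None] x : R)%:E)); last first.
  by apply/funext => x; rewrite /ecabs ec_absE indic_None.
apply: emeasurable_funD.
  apply/measurable_EFinP.
  apply: (measurableT_comp (continuous_measurable_fun (@sqrt_continuous R))).
  by apply: measurable_funD; exact: measurable_funX.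
apply: emeasurable_funM; first exact: measurable_cst.
by case: (Mplus_indic R mN).
Qed.

Lemma Mfun_ecsub f g : Mfun f -> Mfun g -> Mfun (ecsub f g).
Proof.
move=> [mNf mRf mIf] [mNg mRg mIg].
have NE : [set x | ecsub f g x = None] =
    [set x | f x = None] `|` [set x | g x = None].
  apply/seteqP; split=> x; rewrite /ecsub /=.
    by case: (f x) (g x) => [a|] [b|]//=; [right|left|left].
  by case: (f x) (g x) => [a|] [b|]//= [].
have mN : measurable [set x | ecsub f g x = None] by rewrite NE; exact: measurableU.
have mC : measurable_fun [set: T]
    (fun x => 1 - \1_[set x | ecsub f g x = None] x : R)%R.
  exact: measurable_funB.
split=> //.
- rewrite (_ : (fun x => _) = (fun x => (ec_Re (f x) - ec_Re (g x)) *
      (1 - \1_[set x | ecsub f g x = None] x))%R).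
    by apply: measurable_funM => //; exact: measurable_funB.
  apply/funext => x; rewrite indic_None /ecsub.
  by case: (f x) (g x) => [[a b]|] [[a' b']|]; rewrite /= ?subr0 ?subrr ?mulr1 ?mulr0.
- rewrite (_ : (fun x => _) = (fun x => (ec_Im (f x) - ec_Im (g x)) *
      (1 - \1_[set x | ecsub f g x = None] x))%R).
    by apply: measurable_funM => //; exact: measurable_funB.
  apply/funext => x; rewrite indic_None /ecsub.
  by case: (f x) (g x) => [[a b]|] [[a' b']|]; rewrite /= ?subr0 ?subrr ?mulr1 ?mulr0.
Qed.

End Mfun_closure.

Section ec_limit.
Context (R : realType) (d : measure_display) (T : measurableType d).
Variable mu : {measure set T -> \bar R}.
Local Open Scope ereal_scope.

(** Summability of the increments excludes the point at infinity, so the real and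
    imaginary parts converge. *)
Lemma ec_limit (y : nat -> T -> ecomplex R) : (forall n, Mfun (y n)) ->
  exists2 f : T -> ecomplex R, Mfun f &
    forall x, \sum_(n <oo) ecabs (ecsub (y n.+1) (y n)) x < +oo ->
      ec_abs (ec_sub (y n x) (f x)) @[n --> \oo] --> 0.
Proof.
move=> My.
have mR n : measurable_fun [set: T] (fun x => ec_Re (y n x)) by case: (My n).
have mI n : measurable_fun [set: T] (fun x => ec_Im (y n x)) by case: (My n).
have [a ma ya] := measurable_limit mR (fun n x => ec_Re_le (y n.+1 x) (y n x)).
have [b mb yb] := measurable_limit mI (fun n x => ec_Im_le (y n.+1 x) (y n x)).
exists (fun x => Some (Complex (a x) (b x))) => [|x yoo].
  by split=> //; rewrite (_ : [set x | _] = set0)//; apply/seteqP; split.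
have y_some n : exists c, y n x = Some c.
  case E : (y n x) => [c|]; first by exists c.
  have := nneseries_term (h := fun n => ecabs (ecsub (y n.+1) (y n)) x) n.
  move=> /(_ (fun n => ec_abs_ge0 _)) /le_lt_trans /(_ yoo).
  by rewrite /ecabs /ecsub E; case: (y n.+1 x).
have dR : (`|ec_Re (y n x) - a x| : R)%R @[n --> \oo] --> (0 : R)%R.
  rewrite -(normr0 R) -(subrr (a x)); apply: cvg_norm.
  by apply: cvgB; [exact: ya|exact: cvg_cst].
have dI : (`|ec_Im (y n x) - b x| : R)%R @[n --> \oo] --> (0 : R)%R.
  rewrite -(normr0 R) -(subrr (b x)); apply: cvg_norm.
  by apply: cvgB; [exact: yb|exact: cvg_cst].
have dRI : (`|ec_Re (y n x) - a x| + `|ec_Im (y n x) - b x|)%R%:E @[n --> \oo] --> 0.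
  apply: cvg_EFin; first exact: nearW.
  by rewrite -[X in _ --> X](addr0 (0 : R)%R); exact: cvgD.
apply: (squeeze_cvge _ (cvg_cst 0) dRI); apply: nearW => n; rewrite ec_abs_ge0/=.
by have [c ->] := y_some n; exact: ec_abs_sub_le.
Qed.

Lemma ec_cvg_liminf (z v : ecomplex R) (u : nat -> ecomplex R) :
  ec_abs (ec_sub (u n) v) @[n --> \oo] --> 0 ->
  ec_abs (ec_sub z v) <= limn_einf (fun n => ec_abs (ec_sub z (u n))).
Proof.
move=> uv; apply: limn_einf_ge => c cz.
have [c' cc' c'z] : exists2 c' : R, (c < c')%R & c'%:E <= ec_abs (ec_sub z v).
  move: cz; case: (ec_abs _) => [r| |]//; last by exists (c + 1)%R; rewrite ?ltrDl ?leey.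
  by rewrite lte_fin => cr; exists r.
have /fine_cvgP[ufin uv'] := uv.
have c'c : (0 < c' - c)%R by rewrite subr_gt0.
apply: filterS2 ufin (cvgr_lt _ uv' _ c'c) => n unfin un.
have := le_trans c'z (ec_abs_triangle z v (u n)).
move: un; rewrite -lte_fin fineK//; case: (ec_abs (ec_sub (u n) v)) unfin => //= r _.
have := ec_abs_ge0 (ec_sub z (u n)).
case: (ec_abs _) => [s _|_ _ _|//]; last exact: leey.
by rewrite -EFinD !lee_fin lte_fin => *; lra.
Qed.

End ec_limit.

(** * Cauchy nets for the rearranged pairings *)

Section xi_topology.
Context (R : realType) (d : measure_display) (T : measurableType d).
Variable mu : {measure set T -> \bar R}.
Variable rho : (T -> ecomplex R) -> \bar R.
Local Open Scope ereal_scope.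
Hypothesis res : resonant mu.
Hypothesis bn : banach_function_norm mu rho.

Lemma pairingC f g : rearrangement_pairing mu f g = rearrangement_pairing mu g f.
Proof. by apply: eq_integral => t _; rewrite muleC. Qed.

(** The Hardy-Littlewood inequality, read off resonance: a function is a
    rearrangement of itself. *)
Lemma int_le_pairing f g : Mfun f -> Mfun g ->
  \int[mu]_x (ecabs f x * ecabs g x) <= rearrangement_pairing mu f g.
Proof.
by move=> Mf Mg; rewrite -res//; apply: ereal_sup_ubound; exists g.
Qed.

(** By resonance the pairing is a supremum over the rearrangements [p] of [phi] of
    integrals against [|p|], and Fatou's lemma holds for each of these. *)
Lemma pairing_lower_semicontinuous (phi z f : T -> ecomplex R)
    (u : nat -> T -> ecomplex R) c :
  Mfun phi -> Mfun z -> Mfun f -> (forall n, Mfun (u n)) ->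
  {ae mu, forall x, ec_abs (ec_sub (u n x) (f x)) @[n --> \oo] --> 0} ->
  (forall n, rearrangement_pairing mu phi (ecsub z (u n)) <= c) ->
  rearrangement_pairing mu phi (ecsub z f) <= c.
Proof.
move=> Mphi Mz Mf Mu uf uc; have Mzf := Mfun_ecsub Mz Mf.
rewrite pairingC -res//; apply: ge_ereal_sup => _ [p [Mp pphi] <-].
have Mzu n := Mfun_ecsub Mz (Mu n).
have Mp' := Mfun_ecabs Mp.
apply: (@le_trans _ _
    (limn_einf (fun n => \int[mu]_x (ecabs (ecsub z (u n)) x * ecabs p x)))).
  apply: int_fatou.
  - by move=> n; apply: MplusM => //; exact: Mfun_ecabs.
  - by apply: MplusM => //; exact: Mfun_ecabs.
  - apply: filterS uf => x ux; apply: le_trans (limn_einfM _ (Mp'.2 x)); last first.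
      by move=> n; exact: ec_abs_ge0.
    by apply: lee_wpmul2r; [exact: Mp'.2|exact: ec_cvg_liminf].
apply: limn_einf_le; apply: nearW => n; apply: le_trans (uc n).
rewrite pairingC -res//; apply: ereal_sup_ubound.
by exists p.
Qed.

Lemma associate_ball_associate_space v :
  associate_ball mu rho v -> associate_space mu rho (of_Mplus v).
Proof.
move=> [Mv v1]; split; first exact: of_Mplus_Mfun.
apply: (@le_lt_trans _ _ 1); last exact: ltry.
apply: ge_ereal_sup => _ [g [Mg g1] <-]; rewrite ecabs_of_Mplus//.
by apply: v1; [exact: Mfun_ecabs|rewrite (bfn_abs bn)].
Qed.

(** The Hoelder inequality.  Dividing by the norm plus 1 normalizes [f] even when
    its norm is 0. *)
Lemma int_associate_ball_lt_pinfty v f :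
  associate_ball mu rho v -> bf_space rho f ->
  \int[mu]_x (v x * ecabs f x) < +oo.
Proof.
move=> [Mv v1] [Mf foo].
have Maf := Mfun_ecabs Mf; have Nf := bfn_abs bn Mf.
have f_fin : rho f \is a fin_num by rewrite ge0_fin_numE// (bfn_ge0 bn).
pose s := (fine (rho f) + 1)%R.
have s0 : (0 < s)%R by rewrite ltr_wpDl// fine_ge0// (bfn_ge0 bn).
have sV : (0 <= s^-1)%R by rewrite invr_ge0 ltW.
have := v1 (fun x => (s^-1)%:E * ecabs f x).
rewrite (bfn_homog bn)// Nf.
have -> : Mplus (fun x => (s^-1)%:E * ecabs f x) = True.
  by apply/propT/(MplusM _ Maf)/Mplus_cst.
have -> : (s^-1)%:E * rho f <= 1.
  by rewrite -(fineK f_fin) -EFinM lee_fin mulrC ler_pdivrMr// mul1r lerDl.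
move=> /(_ Logic.I isT); under eq_integral do rewrite muleCA.
rewrite (intZ mu sV (MplusM Mv Maf)) => H.
rewrite ltey; apply: contraTN H => /eqP ->.
by rewrite -ltNge gt0_muley ?ltry// lte_fin invr_gt0.
Qed.

Section net.
Variables (I : Type) (le : I -> I -> Prop) (x : I -> T -> ecomplex R).
Hypothesis le_dir : directed le.
Hypothesis xX : forall i, bf_space rho (x i).
Hypothesis x_cauchy : xi_cauchy_net mu rho le x.

(** Finite sets of seminorms already occur in the base of neighbourhoods of 0, so
    one index serves all of [Q]. *)
Lemma cauchy_pairing (Q : set (T -> ecomplex R)) (e : R) :
  finite_set Q -> Q `<=` associate_space mu rho -> (0 < e)%R ->
  exists i0, forall i j, le i0 i -> le i0 j -> forall phi, Q phi ->
    rearrangement_pairing mu phi (ecsub (x i) (x j)) < e%:E.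
Proof.
move=> Qfin QX e0.
have [|i0 Hi0] := x_cauchy (U := [set g | bf_space rho g /\ forall phi, Q phi ->
    rearrangement_pairing mu phi (ecsub g (fun=> Some 0%R)) < e%:E]).
  by exists (Q, e).
exists i0 => i j ii jj phi Qphi; have [_ /(_ _ Qphi)] := Hi0 i j ii jj.
by congr (rearrangement_pairing _ _ _ < _); apply/funext => t; exact: ec_sub0.
Qed.

Lemma directed_upper_bound (k : nat -> I) n :
  exists i, forall m, (m <= n)%N -> le (k m) i.
Proof.
have [_ refl_ trans_ dir] := le_dir.
elim: n => [|n [i Hi]]; first by exists (k 0%N) => m; rewrite leqn0 => /eqP ->.
have [j [ij kj]] := dir i (k n.+1); exists j => m; rewrite leq_eqVlt.
by move=> /predU1P[->//|mn]; apply: trans_ ij; exact: Hi.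
Qed.

(** The limit is built once, from indices [p n] along which the weighted L^1 gaps
    are summable.  Any indices [j n] beyond the same thresholds [k n] stay within
    summable distance of [x (p n)], so they yield the same limit; choosing them
    also beyond [i0] allows the comparison with arbitrary tails of the net. *)
Lemma cauchy_net_limit : sigma_finite [set: T] mu ->
  exists2 f, Mfun f & forall i0, exists2 j : nat -> I,
    forall n, le i0 (j n) &
    {ae mu, forall t, ec_abs (ec_sub (x (j n) t) (f t)) @[n --> \oo] --> 0}.
Proof.
move=> /(positive_associate_weight bn)[w [mw w0 bw]].
have Mw := bw.1; have wX := associate_ball_associate_space bw.
have Mx i : Mfun (x i) by case: (xX i).
have /choice[k Hk] : forall n, exists i0, forall i j, le i0 i -> le i0 j ->
    \int[mu]_t ((w t)%:E * ecabs (ecsub (x i) (x j)) t) <= (half_pow R n)%:E.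
  move=> n; have [||i0 Hi0] := @cauchy_pairing [set of_Mplus (EFin \o w)] _ _ _
    (half_pow_gt0 R n); [exact: finite_set1|by move=> _ ->|].
  exists i0 => i j ii jj; apply: le_trans (ltW (Hi0 i j ii jj _ erefl)).
  apply: le_trans (int_le_pairing _ _); last 2 first.
  - exact: of_Mplus_Mfun.
  - exact: Mfun_ecsub.
  by rewrite ecabs_of_Mplus.
have sum_ae (a b : nat -> I) : (forall n, le (k n) (a n)) ->
    (forall n, le (k n) (b n)) ->
    {ae mu, forall t, \sum_(n <oo) ecabs (ecsub (x (a n)) (x (b n))) t < +oo}.
  move=> ka kb; have Mab n := Mfun_ecabs (Mfun_ecsub (Mx (a n)) (Mx (b n))).
  apply: (summable_ae mw w0) => //.
  apply: (@le_lt_trans _ _ 1); last exact: ltry.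
  rewrite -[leRHS](sum_half_pow R); apply: lee_nneseries => [n _ _|n _].
    by apply: int_ge0; exact: (MplusM Mw).
  exact: Hk.
have /choice[p Hp] := directed_upper_bound k.
have [f Mf yf] := ec_limit (fun n => Mx (p n)).
exists f => // i0.
have [_ _ _ dir] := le_dir.
have /choice[j Hj] : forall n, exists j, le i0 j /\ le (k n) j by move=> n; exact: dir.
exists j; first by move=> n; case: (Hj n).
have ae1 := sum_ae (fun n => p n.+1) p (fun n => Hp n.+1 n (leqnSn n))
  (fun n => Hp n n (leqnn n)).
have ae2 := sum_ae j p (fun n => (Hj n).2) (fun n => Hp n n (leqnn n)).
apply: filterS2 ae1 ae2 => t /yf pf jp.
have jp0 := nneseries_term_cvg0 (fun n => ec_abs_ge0 _) jp.
have sum0 : ec_abs (ec_sub (x (j n) t) (x (p n) t)) +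
    ec_abs (ec_sub (x (p n) t) (f t)) @[n --> \oo] --> 0.
  by rewrite -[X in _ --> X](adde0 0); apply: cvgeD.
apply: (squeeze_cvge _ (cvg_cst 0) sum0); apply: nearW => n.
by rewrite ec_abs_ge0 ec_abs_triangle.
Qed.

(** Lower semicontinuity turns the Cauchy condition into convergence to the almost
    everywhere limit [f].  Integrating the triangle inequality against the
    associate ball then shows that [f] satisfies the Lorentz-Luxemburg criterion. *)
Lemma net_converges : sigma_finite [set: T] mu ->
  exists2 f, bf_space rho f & xi_net_cvg mu rho le x f.
Proof.
move=> sf; have [f Mf f_lim] := cauchy_net_limit sf.
have Mx i : Mfun (x i) by case: (xX i).
have x_cvg (Q : set (T -> ecomplex R)) (e : R) :
    finite_set Q -> Q `<=` associate_space mu rho -> (0 < e)%R ->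
    exists i0, forall i, le i0 i -> forall phi, Q phi ->
      rearrangement_pairing mu phi (ecsub (x i) f) < e%:E.
  move=> Qfin QX e0.
  have e20 : (0 < e / 2)%R by rewrite divr_gt0.
  have [i0 Hi0] := cauchy_pairing Qfin QX e20.
  exists i0 => i ii phi Qphi; have [j i0j jf] := f_lim i0.
  apply: (@le_lt_trans _ _ (e / 2)%:E); last by rewrite lte_fin; lra.
  apply: (pairing_lower_semicontinuous _ (Mx i) Mf (fun n => Mx (j n)) jf).
    by case: (QX _ Qphi).
  by move=> n; exact/ltW/Hi0.
exists f.
  split=> //; rewrite -(bfn_abs bn)//.
  apply: (norm_lt_pinfty_of_associate_ball bn sf); first exact: Mfun_ecabs.
  move=> v bv; have Mv := bv.1.
  have [||i0 Hi0] := x_cvg [set of_Mplus v] 1%R _ _ ltr01.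
  - exact: finite_set1.
  - by move=> _ ->; exact: associate_ball_associate_space.
  have [_ refl_ _ _] := le_dir.
  have := Hi0 i0 (refl_ i0) _ erefl.
  have Mxf := Mfun_ecsub (Mx i0) Mf.
  move=> /(le_lt_trans (int_le_pairing (of_Mplus_Mfun Mv) Mxf)).
  rewrite ecabs_of_Mplus// => vxf.
  have vx := int_associate_ball_lt_pinfty bv (xX i0).
  have Mvx := MplusM Mv (Mfun_ecabs (Mx i0)).
  have Mvxf := MplusM Mv (Mfun_ecabs Mxf).
  apply: (@le_lt_trans _ _ (\int[mu]_t (v t * ecabs (x i0) t +
      v t * ecabs (ecsub (x i0) f) t))).
    apply: int_le; [exact: (MplusM (Mfun_ecabs Mf))|exact: MplusD|move=> t].
    rewrite muleC -ge0_muleDr ?ec_abs_ge0//; apply: lee_wpmul2l; first exact: Mv.2.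
    have := ec_abs_triangle (f t) (Some 0%R) (x i0 t).
    by rewrite !ec_sub0 ec_abs_subC addeC.
  by rewrite intD// lte_add_pinfty// (lt_trans vxf)// ltry.
move=> U [[Q e] /= [Qfin QX e0] QU].
have [i0 Hi0] := x_cvg Q e Qfin QX e0.
by exists i0 => i ii; apply: QU; split=> // phi Qphi; exact: Hi0.
Qed.

End net.
End xi_topology.

Theorem theorem4p19 (R : realType) (d : measure_display)
    (T : measurableType d) (mu : {sigma_finite_measure set T -> \bar R})
    (rho : (T -> ecomplex R) -> \bar R) :
  resonant mu ->
  banach_function_norm mu rho ->
  rearrangement_invariant mu rho ->
  xi_complete mu rho.
Proof.
move=> res bn _ I le x le_dir xX x_cauchy.
exact: (net_converges res bn le_dir xX x_cauchy (sigma_finiteT mu)).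
Qed.
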